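(* Let $X$ be a pseudo-solenoid, and suppose that there is a prime $p$ which appears with a finite exponent in the supernatural number associated to $X$. Then $X$ is not co-existentially closed.
   Context: A continuum is a connected compact Hausdorff space. $C(X)$ denotes the C*-algebra of continuous complex-valued functions on $X$. $T_{\mathrm{conn}}$ denotes a theory of continuous first-order logic in the language of unital C*-algebras whose models are exactly the C*-algebras isomorphic to $C(X)$ for some continuum $X$. A model $M \models T_{\mathrm{conn}}$ is existentially closed if for every $N \models T_{\mathrm{conn}}$ with $M \subseteq N$, every quantifier-free formula $\phi(\overline{x},\overline{y})$ and every tuple $\overline{b}$ from $M$, $(\inf_{\overline{x}}\phi(\overline{x},\overline{b}))^M = (\inf_{\overline{x}}\phi(\overline{x},\overline{b}))^N$. A continuum $X$ is co-existentially closed if $C(X)$ is an existentially closed model of $T_{\mathrm{conn}}$. A metrizable continuum is circle-like (resp. arc-like) if it is homeomorphic to an inverse limit of a sequence of circles $\mathbb{T}$ (resp. of arcs $[0,1]$) with continuous bonding maps. A continuum is hereditarily indecomposable if every subcontinuum is not the union of two proper subcontinua. A pseudo-solenoid is a circle-like, non-arc-like, hereditarily indecomposable metrizable continuum. A supernatural number is a formal product $\prod_{i} n_i$ of positive integers, equivalently a formal product $\prod_{p \text{ prime}} p^{k_p}$ with $k_p \in \{0,1,2,\ldots,\infty\}$. Every pseudo-solenoid $X$ can be written as the inverse limit of a sequence $\mathbb{T} \xleftarrow{f_1} \mathbb{T} \xleftarrow{f_2} \cdots$ of circles with continuous bonding maps of nonzero degrees $d_1, d_2, \ldots$; the supernatural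 number associated to $X$ is $\prod_i |d_i|$, which is well defined up to changing finitely many finite exponents. *)

(* Defs.v *)
From HB Require Import structures.
From mathcomp Require Import all_boot all_order all_algebra.
From mathcomp Require Import all_classical all_reals all_analysis.
From mathcomp Require Import complex.

Set Implicit Arguments.
Unset Strict Implicit.
Unset Printing Implicit Defensive.

Import Order.TTheory GRing.Theory Num.Theory.
Import numFieldNormedType.Exports.
Local Open Scope classical_set_scope.
Local Open Scope ring_scope.
Local Open Scope complex_scope.

(* The library's [connected] and [compact] hold of the empty set; a continuum
   is nonempty. *)
Definition subcontinuum (X : topologicalType) (K : set X) : Prop :=
  [/\ K !=set0, compact K & connected K].

Definition continuum (X : topologicalType) : Prop :=
  hausdorff_space X /\ subcontinuum [set: X].

Definition hereditarily_indecomposable (X : topologicalType) : Prop :=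
  forall K A B : set X, subcontinuum K -> subcontinuum A -> subcontinuum B ->
    K = A `|` B -> A = K \/ B = K.

Definition homeomorphic (X Y : topologicalType) : Prop :=
  exists (f : X -> Y) (g : Y -> X),
    [/\ continuous f, continuous g, cancel f g & cancel g f].

Definition metrizable (R : realType) (X : topologicalType) : Prop :=
  exists M : metricType R, homeomorphic X M.

Definition inverse_limit (X : nat -> topologicalType)
    (f : forall n, X n.+1 -> X n) : topologicalType :=
  set_type [set x : prod_topology X | forall n, f n (x n.+1) = x n].

Definition circle (R : realType) : topologicalType :=
  set_type [set z : R[i]^o | `|z| = 1].

Definition unit_arc (R : realType) : topologicalType :=
  set_type [set` `[0 : R, 1]].

Definition circle_limit (R : realType) (f : nat -> circle R -> circle R) :
    topologicalType :=
  @inverse_limit (fun=> circle R) f.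

Definition arc_limit (R : realType) (f : nat -> unit_arc R -> unit_arc R) :
    topologicalType :=
  @inverse_limit (fun=> unit_arc R) f.

Definition circle_like (R : realType) (X : topologicalType) : Prop :=
  exists f : nat -> circle R -> circle R,
    (forall n, continuous (f n)) /\ homeomorphic X (circle_limit f).

Definition arc_like (R : realType) (X : topologicalType) : Prop :=
  exists f : nat -> unit_arc R -> unit_arc R,
    (forall n, continuous (f n)) /\ homeomorphic X (arc_limit f).

Definition pseudo_solenoid (R : realType) (X : topologicalType) : Prop :=
  [/\ continuum X, metrizable R X, circle_like R X, ~ arc_like R X &
      hereditarily_indecomposable X].

Definition expi (R : realType) (t : R) : R[i]^o :=
  cos (2 * pi * t) +i* sin (2 * pi * t).

Lemma expi_circle (R : realType) (t : R) :
  expi t \in [set z : R[i]^o | `|z| = 1].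
Proof. by rewrite inE /= normc_def /= cos2Dsin2 sqrtr1. Qed.

Definition circle_exp (R : realType) (t : R) : circle R :=
  exist _ (expi t) (expi_circle t).

Definition circle_degree (R : realType) (f : circle R -> circle R) (d : int) :
    Prop :=
  exists F : R -> R,
    [/\ continuous F,
        forall t, f (circle_exp t) = circle_exp (F t) &
        forall t, F (t + 1) = F t + d%:~R].

(* [s p] is the exponent of the prime [p], [None] standing for infinity; the
   values of [s] at non-primes are irrelevant. *)
Definition supernatural := nat -> option nat.

Definition is_supernatural_prod (n : nat -> nat) (s : supernatural) : Prop :=
  forall p, prime p ->
    let e N := (\sum_(i < N) logn p (n i))%N in
    match s p with
    | Some k => \forall N \near \oo, e N = k
    | None => e @ \oo --> \oo
    end.

(* A relation, since the supernatural number depends on the chosen inverse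
   sequence (up to changing finitely many finite exponents). *)
Definition associated_supernatural (R : realType) (X : topologicalType)
    (s : supernatural) : Prop :=
  exists (f : nat -> circle R -> circle R) (d : nat -> int),
    [/\ forall n, continuous (f n),
        forall n, circle_degree (f n) (d n),
        forall n, d n != 0,
        homeomorphic X (circle_limit f) &
        is_supernatural_prod (fun n => `|d n|%N) s].

(* Structures for the language only: the C*-algebra axioms are not imposed
   here, as they hold in every structure isomorphic to some C(X). *)
Record cstar_structure (R : realType) := CstarStructure {
  cs_carrier :> Type;
  cs_zero : cs_carrier;
  cs_one : cs_carrier;
  cs_add : cs_carrier -> cs_carrier -> cs_carrier;
  cs_mul : cs_carrier -> cs_carrier -> cs_carrier;
  cs_scale : R[i] -> cs_carrier -> cs_carrier;
  cs_star : cs_carrier -> cs_carrier;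
  cs_norm : cs_carrier -> R }.

Arguments cs_zero {R} c.
Arguments cs_one {R} c.

Record cstar_embedding (R : realType) (M N : cstar_structure R) (h : M -> N) :
    Prop := CstarEmbedding {
  emb_zero : h (cs_zero M) = cs_zero N;
  emb_one : h (cs_one M) = cs_one N;
  emb_add : forall a b, h (cs_add a b) = cs_add (h a) (h b);
  emb_mul : forall a b, h (cs_mul a b) = cs_mul (h a) (h b);
  emb_scale : forall c a, h (cs_scale c a) = cs_scale c (h a);
  emb_star : forall a, h (cs_star a) = cs_star (h a);
  emb_norm : forall a, cs_norm (h a) = cs_norm a }.

Definition cstar_isomorphic (R : realType) (M N : cstar_structure R) : Prop :=
  exists h : M -> N, cstar_embedding h /\ bijective h.

Inductive cterm (R : realType) (V : Type) : Type :=
| CVar of V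
| CZero
| COne
| CAdd of cterm R V & cterm R V
| CMul of cterm R V & cterm R V
| CScale of R[i] & cterm R V
| CStar of cterm R V.

Fixpoint cterm_eval (R : realType) (V : Type) (M : cstar_structure R)
    (v : V -> M) (t : cterm R V) : M :=
  match t with
  | CVar x => v x
  | CZero => cs_zero M
  | COne => cs_one M
  | CAdd t1 t2 => cs_add (cterm_eval v t1) (cterm_eval v t2)
  | CMul t1 t2 => cs_mul (cterm_eval v t1) (cterm_eval v t2)
  | CScale c t1 => cs_scale c (cterm_eval v t1)
  | CStar t1 => cs_star (cterm_eval v t1)
  end.

(* The metric symbol is not primitive: d(s, t) is the norm of s + (-1) t. *)
Inductive qf_formula (R : realType) (V : Type) : Type :=
| QFNorm of cterm R V
| QFConn (k : nat) (u : 'rV[R]_k -> R) of continuous u &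
    ('I_k -> qf_formula R V).

Fixpoint qf_eval (R : realType) (V : Type) (M : cstar_structure R)
    (v : V -> M) (phi : qf_formula R V) : R :=
  match phi with
  | QFNorm t => cs_norm (cterm_eval v t)
  | @QFConn _ _ k u _ psi => u (\row_i qf_eval v (psi i))
  end.

(* As usual in the language of C*-algebras, a quantified variable ranges over
   a domain of quantification, i.e. a closed ball of given integer radius. *)
Definition qf_inf (R : realType) (m n : nat) (M : cstar_structure R)
    (phi : qf_formula R ('I_m + 'I_n)) (r : 'I_m -> nat) (b : 'I_n -> M) :
    \bar R :=
  ereal_inf [set (qf_eval (fun i => match i with
                                    | inl j => x j
                                    | inr j => b j
                                    end) phi)%:E |
             x in [set x : 'I_m -> M | forall j, cs_norm (x j) <= (r j)%:R]].

Definition existentially_closed (R : realType)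
    (T : cstar_structure R -> Prop) (M : cstar_structure R) : Prop :=
  T M /\
  forall (N : cstar_structure R) (h : M -> N), T N -> cstar_embedding h ->
    forall (m n : nat) (phi : qf_formula R ('I_m + 'I_n)) (r : 'I_m -> nat)
      (b : 'I_n -> M),
      qf_inf phi r b = qf_inf phi r (h \o b).

Section CX.
Context (R : realType) (X : topologicalType).
Local Notation CX := (continuousType X R[i]^o).
Implicit Types f g : CX.

Lemma cx_add_continuous f g : continuous (fun x => f x + g x : R[i]^o).
Proof. by move=> x; apply: cvgD; exact: cts_fun. Qed.

Lemma cx_mul_continuous f g : continuous (fun x => f x * g x : R[i]^o).
Proof. by move=> x; apply: (@cvgM R[i] X); exact: cts_fun. Qed.

Lemma cx_scale_continuous (c : R[i]) f : continuous (fun x => c * f x : R[i]^o).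
Proof.
by move=> x; apply: (@cvgM R[i] X); [exact: cvg_cst|exact: cts_fun].
Qed.

Lemma conjc_continuous : continuous (fun z : R[i]^o => z^* : R[i]^o).
Proof.
move=> z; apply/(@cvgrPdist_lt R[i] R[i]^o _ _ (nbhs_filter (z : R[i]^o))).
move=> e e0; exists e => //= w.
rewrite /ball_ /= -rmorphB /=.
have -> (u : R[i]) : `|u^*| = `|u|.
  by rewrite !normc_def; case: u => a b /=; rewrite sqrrN.
by [].
Qed.

Lemma cx_star_continuous f : continuous (fun x => (f x)^* : R[i]^o).
Proof.
move=> x; apply: (@continuous_comp _ _ _ f); first exact: cts_fun.
exact: conjc_continuous.
Qed.

Definition CX_structure : cstar_structure R :=
  @CstarStructure R CX
    (cst 0) (cst 1)
    (fun f g => mkcts (@cx_add_continuous f g))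
    (fun f g => mkcts (@cx_mul_continuous f g))
    (fun c f => mkcts (@cx_scale_continuous c f))
    (fun f => mkcts (@cx_star_continuous f))
    (fun f => sup [set complex.Re `|f x : R[i]| | x in [set: X]]).

End CX.

(* The theory T_conn enters only through its class of models. *)
Definition Tconn_model (R : realType) (M : cstar_structure R) : Prop :=
  exists X : topologicalType,
    continuum X /\ cstar_isomorphic M (CX_structure R X).

Definition coexistentially_closed (R : realType) (X : topologicalType) : Prop :=
  continuum X /\ existentially_closed (@Tconn_model R) (CX_structure R X).

(* Main.v *)
Require Import Defs.
From mathcomp Require Import all_boot all_order all_algebra.
From mathcomp Require Import all_classical all_reals all_analysis.
From mathcomp Require Import complex ring lra.

(* Drop the first circles, so that p divides none of the degrees, and let u be
   the unitary of C(X) given by the first remaining circle coordinate. The p-fold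
   cover Y = {(x, z) | z^p = u x} of X is connected: if Y were the union of two
   disjoint nonempty closed sets, then so would be, for each n, the parameter line
   of the n-th circle, unless some parameter belongs to points of both sets; such
   pairs of points accumulate at a point common to both sets. In C(Y) the unitary u
   has the p-th root z, so existential closedness provides v in C(X) with v^p close
   to u. Then v / z is close to a single p-th root of unity on the connected space
   Y, which is absurd because (x, z) and (x, zeta z) both lie in Y. *)

Set Implicit Arguments.
Unset Strict Implicit.
Unset Printing Implicit Defensive.

Import Order.TTheory GRing.Theory Num.Theory.
Import numFieldNormedType.Exports.
Local Open Scope classical_set_scope.
Local Open Scope ring_scope.
Local Open Scope complex_scope.

(** * Parametrisation of the unit circle by the real line *)

Section Expi.
Context {R : realType}.
Implicit Types s t : R.

Lemma expiD s t : expi (s + t) = (expi s : R[i]) * expi t.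
Proof.
rewrite /expi mulrDr cosD sinD; apply/eqP; rewrite eq_complex /=.
by rewrite eqxx addrC eqxx.
Qed.

Lemma expi0 : expi (0 : R) = 1.
Proof. by rewrite /expi mulr0 cos0 sin0. Qed.

Lemma expi1 : expi (1 : R) = 1.
Proof. by rewrite /expi mulr1 mulr_natl cos2pi sin2pi. Qed.

Lemma expiMn n t : expi (t *+ n) = (expi t : R[i]) ^+ n.
Proof.
elim: n => [|n IHn]; first by rewrite mulr0n expi0.
by rewrite mulrS expiD IHn exprS.
Qed.

Lemma norm_expi t : `|expi t : R[i]| = 1.
Proof. by rewrite normc_def /= cos2Dsin2 sqrtr1. Qed.

Lemma expi_neq0 t : (expi t : R[i]) != 0.
Proof. by rewrite -normr_eq0 norm_expi oner_eq0. Qed.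

Lemma expi_int (m : int) : expi (m%:~R : R) = 1.
Proof.
have nat1 n : expi (n%:R : R) = 1 by rewrite expiMn expi1 expr1n.
case: m => n; first exact: nat1.
apply: (mulfI (expi_neq0 n.+1%:R)).
by rewrite -expiD NegzE mulrNz subrr expi0 nat1 mulr1.
Qed.

(** By the double-angle formula, the value 1 would force sin (pi t) = 0, while pi t lies strictly
    between 0 and pi. *)
Lemma expi_neq1 t : 0 < t < 1 -> expi t != 1.
Proof.
move=> /andP[t0 t1]; apply/negP => /eqP[cos1 _].
have : cos (pi * t) ^+ 2 = 1.
  move: cos1; rewrite -mulrA mulr_natl cos_mulr2n => h.
  by lra.
rewrite cos2sin2 => /eqP; rewrite subr_eq addrC -subr_eq subrr eq_sym.
rewrite sqrf_eq0; apply/negP; rewrite gt_eqF// sin_gt0_pi//.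
by rewrite mulr_gt0 ?pi_gt0//= gtr_pMr ?pi_gt0.
Qed.

(** [acos] reaches only the upper half circle, so the sign of the imaginary part decides the sign of
    the angle. *)
Lemma expi_surj (z : R[i]) : `|z| = 1 -> exists t, z = expi t.
Proof.
case: z => a b; rewrite normc_def => -[/= ab].
have {}ab : a ^+ 2 + b ^+ 2 = 1.
  by rewrite -[LHS]sqr_sqrtr ?ab ?expr1n// addr_ge0 ?sqr_ge0.
have a1 : -1 <= a <= 1.
  rewrite -ler_norml -(@ler_pXn2r _ 2)// ?nnegrE// expr1n.
  by rewrite real_normK ?num_real// -ab lerDl sqr_ge0.
have pi2 : 2 * pi != 0 :> R by rewrite mulf_neq0// gt_eqF// pi_gt0.
have sinE : sin (acos a) = `|b|.
  by rewrite sin_acos// -ab addrAC subrr add0r sqrtr_sqr.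
have [b0|b0] := leP 0 b.
  exists (acos a / (2 * pi)); rewrite /expi mulrC divfK//.
  by rewrite acosK ?itv_boundlr// sinE ger0_norm.
exists (- acos a / (2 * pi)); rewrite /expi mulrC divfK//.
by rewrite cosN sinN acosK ?itv_boundlr// sinE ltr0_norm// opprK.
Qed.

Lemma prim_root_expi p : (0 < p)%N ->
  p.-primitive_root (expi (p%:R^-1 : R) : R[i]).
Proof.
move=> p0; have pR : p%:R != 0 :> R by rewrite pnatr_eq0 -lt0n.
apply/andP; split=> //; apply/forallP => i; rewrite unity_rootE -expiMn.
have [->|ip] := eqVneq i.+1 p.
  by rewrite -[_ *+ p]mulr_natl divff// expi1 !eqxx.
apply/eqP/negbTE/expi_neq1.
rewrite -[_ *+ _]mulr_natl divr_gt0 ?ltr0n//=.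
by rewrite ltr_pdivrMr ?ltr0n// mul1r ltr_nat ltn_neqAle ip/=.
Qed.

End Expi.

(** * Continuity of complex-valued functions *)

Section ComplexTopology.
Context {R : realType}.

Lemma complex_gt0P (e : R[i]) : 0 < e -> exists2 r : R, 0 < r & e = r%:C.
Proof.
case: e => a b; rewrite ltcE /= => /andP[/eqP-> a0]; by exists a.
Qed.

Lemma Re_norm_le (z : R[i]) (r : R) : (complex.Re `|z| <= r) = (`|z| <= r%:C).
Proof. by rewrite normc_def lecR. Qed.

Lemma norm_realC (r : R) : `|r%:C| = `|r|%:C.
Proof. by rewrite normc_def /= expr0n /= addr0 sqrtr_sqr. Qed.

Lemma complex_continuous (f g : R -> R) : continuous f -> continuous g ->
  continuous (fun t => f t +i* g t : R[i]^o).
Proof.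
move=> cf cg x.
apply/(@cvgrPdist_lt R[i] R[i]^o _ _ (nbhs_filter (x : R))).
move=> _ /complex_gt0P[e e0 ->].
have e20 : 0 < e / 2 by rewrite divr_gt0.
have /cvgrPdist_lt/(_ _ e20) nf := cf x.
have /cvgrPdist_lt/(_ _ e20) ng := cg x.
near=> t.
have nf' : `|f x - f t| < e / 2 by near: t.
have ng' : `|g x - g t| < e / 2 by near: t.
have -> : f x +i* g x - (f t +i* g t) = (f x - f t)%:C + 'i%C * (g x - g t)%:C.
  by simpc.
apply: (le_lt_trans (ler_normD _ _)).
rewrite normrM [`|'i%C|]normc_def /= expr0n expr1n add0r sqrtr1 mul1r !norm_realC.
by rewrite -rmorphD ltcR [e]splitr ltrD.
Unshelve. all: by end_near.
Qed.

Lemma continuous_Re_norm :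
  continuous (fun z : R[i]^o => complex.Re `|z : R[i]|).
Proof.
move=> z.
apply/(@cvgrPdist_lt R R _ _ (nbhs_filter (z : R[i]^o))) => e e0.
exists e%:C => [|w /=]; first by rewrite /= ltcR.
rewrite -ltcR -norm_realC rmorphB /=; apply: le_lt_trans.
have -> (u : R[i]) : (complex.Re `|u|)%:C = `|u| by rewrite normc_def.
exact: ler_dist_dist.
Qed.

Lemma continuous_exprn (T : topologicalType) (f : T -> R[i]^o) n :
  continuous f -> continuous (fun x => (f x : R[i]) ^+ n : R[i]^o).
Proof.
move=> cf; elim: n => [|n IHn] x; first exact: cvg_cst.
rewrite (_ : (fun x => _) = fun x => (f x : R[i]) * f x ^+ n : R[i]^o).
  by apply: (@cvgM R[i] T); [exact: cf|exact: IHn].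
by apply/funext => y; rewrite exprS.
Qed.

Lemma continuous_expi : continuous (@expi R).
Proof.
apply: complex_continuous => t.
  apply: (@continuous_comp _ _ _ (fun t : R => 2 * pi * t) cos).
    exact: mulrl_continuous.
  exact: continuous_cos.
apply: (@continuous_comp _ _ _ (fun t : R => 2 * pi * t) sin).
  exact: mulrl_continuous.
exact: continuous_sin.
Qed.

End ComplexTopology.

(** * Hausdorff and compact subspaces, products and projections *)

Lemma continuous_cluster_eq (T U : topologicalType) (f : T -> U) (x y : T) :
  hausdorff_space U -> continuous f -> cluster (nbhs x) y -> f x = f y.
Proof.
move=> hU cf xy; apply: hU => A B /cf fA /cf fB.
by have [z [Az Bz]] := xy _ _ fA fB; exists (f z).
Qed.

Lemma closed_equalizer (T U : topologicalType) (f g : T -> U) :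
  hausdorff_space U -> continuous f -> continuous g ->
  closed [set x | f x = g x].
Proof.
move=> hU cf cg x clx; apply: hU => A B Ax Bx.
have fA : nbhs x (f @^-1` A) := cf x _ Ax.
have gB : nbhs x (g @^-1` B) := cg x _ Bx.
have [y [fgy [Ay By]]] := clx _ (filterI fA gB).
by exists (f y); split=> //; rewrite fgy.
Qed.

Lemma compact_set_type (T : topologicalType) (A : set T) :
  compact A -> compact [set: set_type A].
Proof.
move=> cA F FF _.
have [|p [Ap clp]] := cA (set_val @ F) (fmap_proper_filter set_val FF).
  by apply: (@filterS _ F _ setT) (@filterT _ F _) => y _; exact: set_valP y.
exists (exist _ p (mem_set Ap)); split=> // B U FB [V [[W oW <-] Wq]] VU.
have imB : (set_val @ F) (set_val @` B).
  by apply: (@filterS _ F _ B) FB => b Bb; exists b.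
have Wp : nbhs p W by exact: open_nbhs_nbhs.
have [_ [[b Bb <-] Wb]] := clp _ _ imB Wp.
by exists b; split=> //; exact: VU.
Qed.

Lemma hausdorff_set_type (T : topologicalType) (A : set T) :
  hausdorff_space T -> hausdorff_space (set_type A).
Proof.
move=> hT x y xy; apply/val_inj/(continuous_cluster_eq hT _ xy).
exact: initial_continuous.
Qed.

Lemma hausdorff_prod (T U : topologicalType) :
  hausdorff_space T -> hausdorff_space U -> hausdorff_space (T * U)%type.
Proof.
move=> hT hU [x x'] [y y'] xy; congr pair.
  by apply: (@continuous_cluster_eq _ _ fst _ _ hT _ xy) => -[a b]; exact: cvg_fst.
by apply: (@continuous_cluster_eq _ _ snd _ _ hU _ xy) => -[a b]; exact: cvg_snd.
Qed.

(** The tube lemma: if the whole fibre over t avoids the closed set, so do the fibres over all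
    nearby points. *)
Lemma closed_proj_compact (T U : topologicalType) (L : set (T * U)) :
  compact [set: U] -> closed L -> closed [set t | exists u, L (t, u)].
Proof.
move=> /compact_near_coveringP cU clL t clt; apply: contrapT => Lt.
have : \forall t' \near t, [set: U] `<=` (fun u => ~ L (t', u)).
  apply: cU => u _.
  have [[P Q] [/= tP uQ] PQ] : nbhs (t, u) (~` L).
    apply: open_nbhs_nbhs; split; first exact: closed_openC.
    by move=> Ltu; apply: Lt; exists u.
  by exists (Q, P) => // -[u' t'] [/= Qu' Pt']; exact: (PQ (t', u')).
by move=> /clt[t' [[u Ltu]]] /(_ u I).
Qed.

(** * Degrees of lifts, and the p-fold cyclic cover of an inverse limit of circles *)

Lemma degree_shift (R : realType) (F : R -> R) (d m : int) (t : R) :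
  (forall t, F (t + 1) = F t + d%:~R) -> F (t + m%:~R) = F t + (m * d)%:~R.
Proof.
move=> Fd; have Fn n u : F (u + n%:R) = F u + (n%:Z * d)%:~R.
  elim: n => [|n IHn]; first by rewrite mul0r !addr0.
  by rewrite -natr1 addrA Fd IHn -addrA -intrD -addn1 PoszD mulrDl mul1r.
case: m => n; first exact: Fn.
have := Fn n.+1 (t - n.+1%:R); rewrite subrK NegzE mulrNz mulNr => ->.
by rewrite mulrNz addrK.
Qed.

Section CyclicCover.
Context {R : realType} {X : topologicalType}.
Variables (c : nat -> X -> R[i]^o) (F : nat -> R -> R) (d : nat -> int).
Variable p : nat.
Hypothesis continuumX : continuum X.
Hypothesis c_continuous : forall n, continuous (c n).
Hypothesis c_expi : forall n x, exists t, c n x = expi t.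
Hypothesis c_bond : forall n x t, c n.+1 x = expi t -> c n x = expi (F n t).
Hypothesis c_inj : forall x y, (forall n, c n x = c n y) -> x = y.
Hypothesis c_surj : forall n t, exists x, c n x = expi t.
Hypothesis F_continuous : forall n, continuous (F n).
Hypothesis F_degree : forall n t, F n (t + 1) = F n t + (d n)%:~R.
Hypothesis p_gt0 : (0 < p)%N.
Hypothesis p_coprime : forall n, coprimez (d n) p.

(** Lift of the composite bonding map from circle n down to circle 0. *)
Fixpoint bonding n : R -> R := if n is m.+1 then bonding m \o F m else id.

Lemma bonding_continuous n : continuous (bonding n).
Proof.
elim: n => [|n IHn] t; first exact: cvg_id.
by apply: continuous_comp; [exact: F_continuous|exact: IHn].
Qed.

(** D is the product of the first n degrees, each prime to p. *)
Lemma bonding_degree n : exists D : int, coprimez D p /\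
  forall t (m : int), bonding n (t + m%:~R) = bonding n t + (m * D)%:~R.
Proof.
elim: n => [|n [D [Dp IHn]]].
  by exists 1; split=> [|t m]; [rewrite coprimezE coprime1n|rewrite mulr1].
exists (d n * D); split=> [|t m]; first by rewrite coprimezMl p_coprime.
by rewrite /= (degree_shift _ _ (F_degree n)) IHn mulrA.
Qed.

Lemma coord_bondingE n x t : c n x = expi t -> c 0 x = expi (bonding n t).
Proof. by elim: n t => [|n IHn] t //= /c_bond/IHn. Qed.

Lemma coord_eq_le n k x y : (k <= n)%N -> c n x = c n y -> c k x = c k y.
Proof.
move=> /subnK <-; elim: (n - k)%N => [//|m IHm] E; apply: IHm.
have [t xt] := c_expi (m.+1 + k) x.
by rewrite (c_bond xt) -(c_bond (etrans (esym E) xt)).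
Qed.

(** The pullback of the p-th power map of the circle along [c 0]. The plane can replace the circle
    because p-th roots of numbers of modulus 1 have modulus 1. *)
Definition root_cover : topologicalType :=
  set_type [set y : X * R[i]^o | (y.2 : R[i]) ^+ p = c 0 y.1].

Definition cover_base (y : root_cover) : X := (set_val y).1.
Definition cover_root (y : root_cover) : R[i]^o := (set_val y).2.

Lemma cover_base_continuous : continuous cover_base.
Proof.
move=> y; apply: (@continuous_comp _ _ _ set_val fst).
  exact: initial_continuous.
by case: (set_val y) => a b; exact: cvg_fst.
Qed.

Lemma cover_root_continuous : continuous cover_root.
Proof.
move=> y; apply: (@continuous_comp _ _ _ set_val snd).
  exact: initial_continuous.
by case: (set_val y) => a b; exact: cvg_snd.
Qed.

Lemma cover_rootX y : (cover_root y : R[i]) ^+ p = c 0 (cover_base y).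
Proof. exact: set_valP y. Qed.

Lemma cover_ex x (z : R[i]) : z ^+ p = c 0 x ->
  exists y, cover_base y = x /\ cover_root y = z.
Proof. by move=> xz; exists (exist _ (x, z) (mem_set xz)). Qed.

Lemma cover_eq y y' : cover_base y = cover_base y' ->
  cover_root y = cover_root y' -> y = y'.
Proof.
rewrite /cover_base /cover_root => e1 e2; apply: val_inj.
by apply/eqP; rewrite -pair_eqE /= /pair_eq; apply/andP; split; apply/eqP.
Qed.

Lemma cover_root_expi y : exists t, cover_root y = expi t.
Proof.
apply: expi_surj; have [t xt] := c_expi 0 (cover_base y).
by apply: (pexpIrn p_gt0); rewrite ?nnegrE// -normrX cover_rootX xt norm_expi expr1n.
Qed.

(** The plane is not compact, but the cover is closed in the product of X with the circle, the image
    of [0, 1] under [expi]. *)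
Lemma root_cover_compact : compact [set: root_cover].
Proof.
apply: compact_set_type.
have cX : compact [set: X] by case: continuumX => _ [].
have cI : compact (@expi R @` `[0, 1]).
  apply: continuous_compact; last exact: segment_compact.
  exact/continuous_subspaceT/continuous_expi.
apply: subclosed_compact (compact_setX cX cI) _.
  apply: (@closed_equalizer _ R[i]^o (fun y : X * R[i]^o => (y.2 : R[i]) ^+ p)
    (fun y => c 0 y.1)); first exact: norm_hausdorff.
  - apply: continuous_exprn => -[a b]; exact: cvg_snd.
  - move=> [a b]; apply: (@continuous_comp _ _ _ fst (c 0)).
      exact: cvg_fst.
    exact: c_continuous.
move=> [x z] xz; split => //=.
have [t zt] := cover_root_expi (exist _ (x, z) (mem_set xz)).
(* The fractional part of t parametrises the same point of the circle. *)
exists (t - (Num.floor t)%:~R).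
  have /andP[t1 t2] := floor_itv t.
  by rewrite /= in_itv /= subr_ge0 t1 lerBlDl ltW// -intrD1.
by rewrite (zt : z = expi t) -mulrNz [LHS]expiD expi_int mulr1.
Qed.

Lemma root_cover_hausdorff : hausdorff_space root_cover.
Proof.
apply/hausdorff_set_type/hausdorff_prod; first by case: continuumX.
exact: norm_hausdorff.
Qed.

(** The real line parametrises the n-th approximation of the cover; this is a relation because
    several points of the cover may lie over one t. *)
Definition level n (t : R) (y : root_cover) : Prop :=
  c n (cover_base y) = expi t /\ cover_root y = expi (bonding n t / p%:R).

Lemma pdiv_expi (t : R) : (expi (t / p%:R) : R[i]) ^+ p = expi t.
Proof.
by rewrite -expiMn -[t / _ *+ p]mulr_natr divfK// pnatr_eq0 -lt0n.
Qed.

Lemma level_ex n t : exists y, level n t y.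
Proof.
have [x xt] := c_surj n t.
have [|y [yx yz]] := @cover_ex x (expi (bonding n t / p%:R)).
  by rewrite (coord_bondingE xt) pdiv_expi.
by exists y; split=> //; rewrite yx.
Qed.

(* c n determines t only up to an integer; as the degree D of the bonding map is
   prime to p, integer shifts of t reach all p roots. *)
Lemma level_cover n y : exists t, level n t y.
Proof.
have [t xt] := c_expi n (cover_base y).
have pR : p%:R != 0 :> R by rewrite pnatr_eq0 -lt0n.
pose z0 : R[i] := expi (bonding n t / p%:R).
have z0N0 : z0 != 0 := expi_neq0 _.
have zp : ((cover_root y : R[i]) / z0) ^+ p = 1.
  rewrite expr_div_n cover_rootX pdiv_expi (coord_bondingE xt) divff//.
  exact: expi_neq0.
have [j zj] := prim_rootP (prim_root_expi p_gt0) zp.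
have [D [/coprimezP[[u v] /= uv] Dt]] := bonding_degree n.
(* As u D + v p = 1, the shift by j u adds j u D / p = j / p - j v to the parameter of the root,
   which multiplies the root by the j-th power of the primitive one. *)
exists (t + (j%:Z * u)%:~R); split.
  by rewrite [RHS]expiD expi_int mulr1.
have -> : bonding n (t + (j%:Z * u)%:~R) / p%:R =
    bonding n t / p%:R + (p%:R^-1 *+ j + (- (j%:Z * v))%:~R).
  rewrite Dt -mulrA (_ : u * D = 1 - v * p%:Z); last by rewrite -uv addrK.
  rewrite mulrDl; congr (_ + _).
  rewrite mulrDr mulr1 intrD mulrDl mulrC mulr_natr; congr (_ + _).
  by rewrite mulrN mulrA !mulrNz mulNr [(_ * p%:Z)%:~R]intrM mulfK.
rewrite !expiD expi_int mulr1 expiMn -zj.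
by rewrite mulrC divfK.
Qed.

(** Two points over the same parameter at level n have equal roots and agree in the coordinates up
    to n. By compactness such pairs accumulate at some (a, b) in A x B; all these equalities are
    closed conditions, so a and b agree in every coordinate. *)
Lemma level_limit (A B : set root_cover) : closed A -> closed B ->
  (forall n, exists a b t, [/\ A a, B b, level n t a & level n t b]) ->
  A `&` B !=set0.
Proof.
move=> clA clB AB.
have [s sP] := choice (fun n => let: ex_intro a (ex_intro b H) := AB n in
   ex_intro (fun q : root_cover * root_cover => exists t, 
     [/\ A q.1, B q.2, level n t q.1 & level n t q.2]) (a, b) H).
have cpt : compact (A `*` B).
  by apply: compact_setX; apply: (subclosed_compact _ root_cover_compact).
have [|[a b] [[/= Aa Bb]]] := cpt (s @ \oo) _.
  by exists 0%N => // n _; have [t []] := sP n.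
rewrite clusterE => clab.
suff ab : a = b by exists a; split=> //; rewrite ab.
(* The cluster point (a, b) lies in the closure of every set that eventually contains the chosen
   pairs. *)
have eq_lim (f : root_cover -> R[i]^o) : continuous f ->
    (\forall n \near \oo, f (s n).1 = f (s n).2) -> f a = f b.
  move=> cf fs.
  have cl : closed [set q : root_cover * root_cover | f q.1 = f q.2].
    apply: closed_equalizer; first exact: norm_hausdorff.
      move=> [u v]; apply: (@continuous_comp _ _ _ fst f); first exact: cvg_fst.
      exact: cf.
    move=> [u v]; apply: (@continuous_comp _ _ _ snd f); first exact: cvg_snd.
    exact: cf.
  exact: (cl _ (clab [set q | f q.1 = f q.2] fs)).
apply: cover_eq.
  apply: c_inj => k; apply: (eq_lim (c k \o cover_base)).
    move=> y; apply: continuous_comp; first exact: cover_base_continuous.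
    exact: c_continuous.
  exists k => // n /= kn; apply: coord_eq_le kn _.
  by have [t [_ _ [-> _] [-> _]]] := sP n.
apply: (eq_lim cover_root); first exact: cover_root_continuous.
by exists 0%N => // n _; have [t [_ _ [_ ->] [_ ->]]] := sP n.
Qed.

(** The parameters are the projection of a closed set along the compact cover. *)
Lemma closed_level n (A : set root_cover) : closed A ->
  closed [set t | exists y, (level n t y /\ A y)].
Proof.
move=> clA.
apply: (@closed_proj_compact R root_cover [set q | level n q.1 q.2 /\ A q.2]).
  exact: root_cover_compact.
apply: closedI; last first.
  apply: (@preimage_closed _ _ snd) => // -[a b] _; exact: cvg_snd.
have c1 : continuous (fst : R * root_cover -> R) by move=> [a b]; exact: cvg_fst.
have c2 : continuous (snd : R * root_cover -> root_cover).
  by move=> [a b]; exact: cvg_snd.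
apply: closedI; apply: closed_equalizer; try exact: norm_hausdorff.
- move=> q; apply: (@continuous_comp _ _ _ snd (c n \o cover_base)).
    exact: c2.
  apply: continuous_comp; first exact: cover_base_continuous.
  exact: c_continuous.
- move=> q; apply: (@continuous_comp _ _ _ fst (@expi R)); first exact: c1.
  exact: continuous_expi.
- move=> q; apply: (@continuous_comp _ _ _ snd cover_root); first exact: c2.
  exact: cover_root_continuous.
- move=> q; apply: (@continuous_comp _ _ _ fst (fun t => expi (bonding n t / p%:R))).
    exact: c1.
  apply: continuous_comp; last exact: continuous_expi.
  apply: cvgMl; exact: bonding_continuous.
Qed.

Lemma root_cover_connected : connected [set: root_cover].
Proof.
move=> A [a Aa] [U oU]; rewrite setTI => AU [V clV]; rewrite setTI => AV.
have clA : closed A by rewrite AV.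
have clnA : closed (~` A) by apply: open_closedC; rewrite AU.
apply: contrapT => nAT; have [b nAb] : exists b, ~ A b.
  by apply/existsNP => AT; apply/nAT/seteqP; split=> // x _; exact: AT.
suff [x []] : A `&` ~` A !=set0 by [].
apply: level_limit => // n.
pose S (B : set root_cover) := [set t | exists y, level n t y /\ B y].
apply: contrapT => ABn.
(* Every parameter lies under some point of the cover, and by [ABn] none lies under points of both
   sets; hence [S A] is open and closed in the line. *)
have SA : S A = ~` S (~` A).
  apply/seteqP; split=> t /=.
    move=> [y [ty Ay]] [y' [ty' Ay']]; apply: ABn; by exists y, y', t.
  move=> nAt; have [y ty] := level_ex n t; exists y; split=> //.
  by apply: contrapT => nAy; apply: nAt; exists y.
have cR : connected [set: R] by exact/connected_intervalP.
(* The parameters of a and b show that [S A] and its complement are both nonempty. *)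
have [ta aP] := level_cover n a.
have [tb bP] := level_cover n b.
have : S A = setT.
  apply: cR.
  - by exists ta; exists a.
  - exists (S A); last by rewrite setTI.
    by rewrite SA; apply/closed_openC/closed_level.
  - exists (S A); last by rewrite setTI.
    exact: closed_level.
by rewrite SA => /seteqP[_ /(_ tb I)]; apply; exists b.
Qed.

Lemma root_cover_continuum : continuum root_cover.
Proof.
split; first exact: root_cover_hausdorff.
split; [|exact: root_cover_compact|exact: root_cover_connected].
by have [y _] := level_ex 0 0; exists y.
Qed.

End CyclicCover.

(** * Numbers whose p-th power is close to 1 *)

Lemma finite_lower_bound (R : realType) (a : nat -> R) (P : pred nat) n :
  (forall i, (i < n)%N -> P i -> 0 < a i) ->
  exists2 r, 0 < r & forall i, (i < n)%N -> P i -> r <= a i.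
Proof.
elim: n => [|n IHn] a0; first by exists 1.
have [i ni|r r0 ra] := IHn; first by apply: a0; exact: ltnW.
have [Pn|nPn] := boolP (P n).
  exists (Num.min r (a n)); first by rewrite lt_min r0 a0.
  move=> i; rewrite ltnS leq_eqVlt => /predU1P[-> _|ni Pi].
    by rewrite ge_min lexx orbT.
  by rewrite ge_min ra.
exists r => // i; rewrite ltnS leq_eqVlt => /predU1P[->|]; last exact: ra.
by rewrite (negbTE nPn).
Qed.

Section RootsOfUnity.
Context {R : realType}.
Local Notation nm z := (complex.Re `|z : R[i]|).
Implicit Types z w : R[i].

Lemma real_complexD (a b : R) : (a + b)%:C = a%:C + b%:C.
Proof. exact: rmorphD. Qed.

Lemma real_complexM (a b : R) : (a * b)%:C = a%:C * b%:C.
Proof. exact: rmorphM. Qed.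

Lemma Re_normE z : (nm z)%:C = `|z|.
Proof. by rewrite normc_def. Qed.

Lemma Re_normM z w : nm (z * w) = nm z * nm w.
Proof. by apply: complexI; rewrite real_complexM !Re_normE normrM. Qed.

Lemma Re_normB_le z w u : nm (z - w) <= nm (z - u) + nm (w - u).
Proof.
by rewrite -lecR real_complexD !Re_normE [`|w - u|]distrC ler_distD.
Qed.

Lemma Re_norm_eq0 z : (nm z == 0) = (z == 0).
Proof. by rewrite -(inj_eq (@complexI R)) Re_normE normr_eq0. Qed.

Lemma Re_norm_ge0 z : 0 <= nm z.
Proof. by rewrite -lecR Re_normE; exact: normr_ge0. Qed.

Lemma mulcJ_rotate (a b z : R[i]) : `|z| = 1 -> a * conjc b = a * conjc (b * z) * z.
Proof.
move=> z1; have -> : conjc (b * z) = conjc b * conjc z by exact: rmorphM.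
by rewrite -!mulrA [conjc z * _]mulrC -sqr_normc z1 expr1n mulr1.
Qed.

Variables (p : nat) (zeta : R[i]).
Hypothesis zeta_prim : p.-primitive_root zeta.

(** The product of the p factors w - zeta^j is w^p - 1; if all of them had modulus at least eta, it
    would have modulus at least eta^p. *)
Lemma near_root_of_unity (w : R[i]) (eta : R) : 0 <= eta ->
  nm (w ^+ p - 1) < eta ^+ p -> exists j : 'I_p, nm (w - zeta ^+ j) < eta.
Proof.
move=> eta0; apply: contraPP => /forallNP wj; apply/negP.
have -> : w ^+ p - 1 = \prod_(j < p) (w - zeta ^+ j).
  have := congr1 (horner^~ w) (factor_Xn_sub_1 zeta_prim).
  rewrite horner_prod big_mkord !hornerE => <-.
  by apply: eq_bigr => j _; rewrite !hornerE.
rewrite -leNgt -lecR Re_normE normr_prod rmorphXn /=.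
rewrite -[X in _ ^+ X]card_ord -prodr_const; apply: ler_prod => j _.
rewrite -Re_normE !lecR eta0 leNgt; exact/negP.
Qed.

(** The factor 3 keeps the open eta-ball around one root disjoint from the closed 2 eta-ball around
    any other. *)
Lemma root_gap : exists2 eta : R, 0 < eta &
  forall i, (0 < i < p)%N -> 3 * eta <= nm (zeta ^+ i - 1).
Proof.
have [i ip i0|r r0 rP] := @finite_lower_bound R
  (fun i => nm (zeta ^+ i - 1)) (fun i => 0 < i)%N p.
  rewrite lt0r Re_norm_ge0 andbT Re_norm_eq0 subr_eq0.
  rewrite -[X in _ != X](expr0 zeta) (eq_prim_root_expr zeta_prim).
  by rewrite mod0n modn_small -?lt0n.
exists (r / 3) => [|i /andP[i0 ip]]; first by rewrite divr_gt0.
by rewrite mulrC divfK ?rP.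
Qed.

(** Rotation by zeta^i preserves distances, which reduces to the distance between 1 and zeta^(j -
    i). *)
Lemma root_gap_distinct (eta : R) (i j : 'I_p) : 0 < eta ->
  (forall i, (0 < i < p)%N -> 3 * eta <= nm (zeta ^+ i - 1)) ->
  nm (zeta ^+ i - zeta ^+ j) < 3 * eta -> i = j.
Proof.
move=> eta0 gap.
wlog ij : i j / (i <= j)%N.
  move=> W; have [|/ltnW ji] := leqP i j; first exact: W.
  have -> : nm (zeta ^+ i - zeta ^+ j) = nm (zeta ^+ j - zeta ^+ i).
    by rewrite distrC.
  by move=> /(W _ _ ji).
move=> ltij; apply/val_inj/eqP; rewrite eqn_leq ij /= leqNgt; apply/negP => ltn.
have := gap (j - i)%N; rewrite subn_gt0 ltn (leq_ltn_trans (leq_subr _ _)) //.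
move=> /(_ isT); apply/negP; rewrite -ltNge; apply: le_lt_trans ltij.
have zi : nm (zeta ^+ i) = 1.
  have : `|zeta ^+ i| = 1.
    apply: (pexpIrn (prim_order_gt0 zeta_prim)); rewrite ?nnegrE//.
    by rewrite -normrX exprAC (prim_expr_order zeta_prim) !expr1n normr1.
  by move=> ->.
have -> : zeta ^+ i - zeta ^+ j = (1 - zeta ^+ (j - i)) * zeta ^+ i.
  by rewrite mulrBl mul1r -exprD subnK.
by rewrite Re_normM zi mulr1 distrC.
Qed.

Lemma connected_near_root (Y : topologicalType) (w : Y -> R[i]^o) (eta : R) :
  connected [set: Y] -> continuous w -> 0 < eta ->
  (forall i, (0 < i < p)%N -> 3 * eta <= nm (zeta ^+ i - 1)) ->
  (forall y, nm ((w y : R[i]) ^+ p - 1) < eta ^+ p) ->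
  forall (j : 'I_p) y y', nm (w y - zeta ^+ j) < eta ->
    nm (w y' - zeta ^+ j) < eta.
Proof.
move=> cY cw eta0 gap wp j y y' wyj.
pose g y := nm (w y - zeta ^+ j).
have cg : continuous g.
  move=> u; apply: (@continuous_comp _ _ _ (fun y => w y - zeta ^+ j : R[i]^o)).
    by apply: cvgB; [exact: cw|exact: cvg_cst].
  exact: continuous_Re_norm.
(* A value within 2 eta of zeta^j is within eta of some zeta^i, and then i = j by the gap. The left
   side is open and the right side closed. *)
have gE : [set u | g u < eta] = [set u | g u <= 2 * eta].
  apply/seteqP; split=> u /= gu; first by lra.
  have [i ui] := near_root_of_unity (ltW eta0) (wp u).
  suff ij : i = j by rewrite /g -ij.
  apply: (root_gap_distinct eta0 gap).
  have -> : nm (zeta ^+ i - zeta ^+ j) = nm ((w u - zeta ^+ j) - (w u - zeta ^+ i)).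
    congr complex.Re; congr `|_|; ring.
  have := Re_normB_le (w u - zeta ^+ j) (w u - zeta ^+ i) 0.
  rewrite !subr0 => /le_lt_trans; apply.
  by rewrite -/(g u); lra.
suff : [set u | g u < eta] = setT by move=> /seteqP[_ /(_ y' I)].
apply: cY; first by exists y.
  exists [set u | g u < eta]; last by rewrite setTI.
  by apply: (@open_comp _ _ g [set r | r < eta]) => //; exact: open_lt.
exists [set u | g u < eta]; last by rewrite setTI.
rewrite gE; apply: (@preimage_closed _ _ g [set r | r <= 2 * eta]) => //.
Qed.

End RootsOfUnity.

(** * The first coordinate has no approximate p-th root on X *)

Section NoRoot.
Context {R : realType} {X : topologicalType}.
Local Notation nm z := (complex.Re `|z : R[i]|).
Variables (c : nat -> X -> R[i]^o) (p : nat).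
Hypothesis c_expi : forall n x, exists t, c n x = expi t.
Hypothesis p_gt1 : (1 < p)%N.
Hypothesis connY : connected [set: root_cover c p].

(* On the connected cover, the quotient of v by the tautological root z of c 0
   stays close to a single p-th root of unity; but passing from (x, z) to
   (x, zeta z) rotates it. *)
Lemma no_approximate_root : [set: root_cover c p] !=set0 ->
  exists2 e : R, 0 < e & forall v : X -> R[i]^o, continuous v ->
    ~ forall x, nm ((v x : R[i]) ^+ p - c 0 x) < e.
Proof.
move=> [y _]; have p0 := ltnW p_gt1.
pose zeta : R[i] := expi (p%:R^-1 : R).
have zeta_prim : p.-primitive_root zeta := prim_root_expi p0.
have [eta eta0 gap] := root_gap zeta_prim.
exists (eta ^+ p); first by rewrite exprn_gt0.
move=> v cv ve.
(* The root has modulus 1, so multiplying by its conjugate is dividing by it. *)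
pose w (y : root_cover c p) : R[i]^o :=
  (v (cover_base y) : R[i]) * conjc (cover_root y).
have rootN1 (u : root_cover c p) : (cover_root u : R[i]) * conjc (cover_root u) = 1.
  have [t ->] := cover_root_expi c_expi p0 u.
  by rewrite -sqr_normc norm_expi expr1n.
have cw : continuous w.
  have cb : continuous (v \o @cover_base R X c p).
    move=> u; apply: continuous_comp; last exact: cv.
    exact: cover_base_continuous.
  have cr : continuous ((fun z => conjc z : R[i]^o) \o @cover_root R X c p).
    move=> u; apply: continuous_comp; last exact: conjc_continuous.
    exact: cover_root_continuous.
  move=> u; exact: (@cvgM R[i] (root_cover c p) (nbhs u) _ _ _ _ _ (cb u) (cr u)).
have wp u : nm ((w u : R[i]) ^+ p - 1) < eta ^+ p.
  have -> : (w u : R[i]) ^+ p - 1 =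
      ((v (cover_base u) : R[i]) ^+ p - c 0 (cover_base u)) *
      conjc (cover_root u) ^+ p.
    have r1 : (c 0 (cover_base u) : R[i]) * conjc (cover_root u) ^+ p = 1.
      by rewrite -cover_rootX -exprMn rootN1 expr1n.
    by rewrite [RHS]mulrBl r1 exprMn.
  rewrite Re_normM [X in _ * X](_ : _ = 1) ?mulr1; first exact: ve.
  have [t ->] := cover_root_expi c_expi p0 u.
  by rewrite normrX normcJ norm_expi expr1n.
have [j yj] := near_root_of_unity zeta_prim (ltW eta0) (wp y).
have [|y' [yb yr]] := @cover_ex R X c p (cover_base y)
  ((cover_root y : R[i]) * zeta).
  by rewrite exprMn (prim_expr_order zeta_prim) mulr1 cover_rootX.
have y'j := connected_near_root zeta_prim connY cw eta0 gap wp y' yj.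
have wyy' : (w y : R[i]) = w y' * zeta.
  rewrite /w yb yr; apply: mulcJ_rotate; exact: norm_expi.
have zetaN : nm zeta = 1 by rewrite norm_expi.
(* Both w y = zeta w y' and w y' are within eta of zeta^j, so zeta^j zeta and zeta^j are less than 2
   eta apart. This contradicts the gap at exponent 1, which is in range since p > 1. *)
have : nm (zeta ^+ 1 - 1) < 3 * eta.
  rewrite expr1.
  have zj : nm (zeta ^+ j) = 1 by rewrite normrX norm_expi expr1n.
  have -> : nm (zeta - 1) = nm (zeta ^+ j * zeta - zeta ^+ j).
    by rewrite -{2}[zeta ^+ j]mulr1 -mulrBr Re_normM zj mul1r.
  apply: le_lt_trans (Re_normB_le _ _ (w y)) _.
  have -> : nm (zeta ^+ j * zeta - w y) = nm (w y' - zeta ^+ j).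
    rewrite wyy' -mulrBl Re_normM zetaN mulr1; congr complex.Re; exact: distrC.
  have -> : nm (zeta ^+ j - w y) = nm (w y - zeta ^+ j).
    congr complex.Re; exact: distrC.
  by lra.
by apply/negP; rewrite -leNgt gap.
Qed.

End NoRoot.

(** * Function algebras and transfer of roots by existential closedness *)

Section FunctionAlgebra.
Context {R : realType}.
Local Notation nm z := (complex.Re `|z : R[i]|).

(** [sup] takes a default value on empty or unbounded sets; compactness gives the bound here, and
    [CX_norm_le] asks for a nonempty space. *)
Lemma CX_norm_ge (X : topologicalType) (f : CX_structure R X) (x : X) :
  compact [set: X] -> nm ((f : continuousType X R[i]^o) x) <= cs_norm f.
Proof.
move=> cX; apply: sup_upper_bound; last by exists x.
apply: compact_has_sup; first by eexists; exists x.
apply: continuous_compact cX; apply: continuous_subspaceT => y.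
apply: (@continuous_comp _ _ _ (f : continuousType X R[i]^o)
  (fun z : R[i]^o => nm z)); first exact: cts_fun.
exact: continuous_Re_norm.
Qed.

Lemma CX_norm_le (X : topologicalType) (f : CX_structure R X) (r : R) :
  [set: X] !=set0 -> (forall x, nm ((f : continuousType X R[i]^o) x) <= r) ->
  cs_norm f <= r.
Proof.
move=> [x0 _] fr; apply: ge_sup; first by eexists; exists x0.
by move=> _ [x _ <-]; exact: fr.
Qed.

Lemma cstar_isomorphic_refl (M : cstar_structure R) : cstar_isomorphic M M.
Proof. by exists id; split; [split|exists id]. Qed.

Lemma CX_comp_continuous (X Y : topologicalType) (g : Y -> X)
  (f : continuousType X R[i]^o) : continuous g -> continuous (f \o g).
Proof. by move=> cg y; apply: continuous_comp; [exact: cg|exact: cts_fun]. Qed.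

Definition CX_comp (X Y : topologicalType) (g : Y -> X) (cg : continuous g)
  (f : CX_structure R X) : CX_structure R Y :=
  mkcts (@CX_comp_continuous X Y g f cg).

Lemma CX_comp_embedding (X Y : topologicalType) (g : Y -> X)
    (cg : continuous g) :
  (forall x, exists y, g y = x) -> cstar_embedding (CX_comp cg).
Proof.
move=> gs; split=> *; try exact/continuousEP.
(* For the norm: as g is onto, both suprema run over the same set of values. *)
congr (sup _); apply/seteqP; split=> _ [x _ <-]; first by exists (g x).
by have [y <-] := gs x; exists y.
Qed.

Fixpoint cterm_pow (V : Type) (t : cterm R V) n : cterm R V :=
  if n is m.+1 then CMul t (cterm_pow t m) else COne R V.

Lemma cterm_pow_eval (V : Type) (X : topologicalType)
    (v : V -> CX_structure R X) t n x :
  (cterm_eval v (cterm_pow t n) : continuousType X R[i]^o) x =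
  ((cterm_eval v t : continuousType X R[i]^o) x : R[i]) ^+ n.
Proof. by elim: n => [|n IHn] //; rewrite exprS -IHn. Qed.

(** The norm of x^n - u, where [inl] marks the variable x bound by the infimum and [inr] the
    parameter u. *)
Definition root_formula n : qf_formula R ('I_1 + 'I_1) :=
  QFNorm (CAdd (cterm_pow (CVar R (inl ord0)) n)
               (CScale (-1) (CVar R (inr ord0)))).

(** The exact root z lies in the unit ball of C(Y) and makes the infimum of [root_formula] at most 0
    there. The infimum in C(X) is the same, so some v comes below e. *)
Lemma coexistentially_closed_root (X Y : topologicalType) (g : Y -> X)
    (u : X -> R[i]^o) (z : Y -> R[i]^o) n :
  coexistentially_closed R X -> continuum Y -> continuous g ->
  (forall x, exists y, g y = x) -> continuous u -> continuous z ->
  (forall y, `|z y : R[i]| <= 1) -> (forall y, (z y : R[i]) ^+ n = u (g y)) ->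
  forall e : R, 0 < e -> exists2 v : X -> R[i]^o, continuous v &
    forall x, nm ((v x : R[i]) ^+ n - u x) < e.
Proof.
move=> [contX [_ ecX]] contY cg gs cu cz z1 zu e e0.
have cX : compact [set: X] by case: contX => _ [].
have Y0 : [set: Y] !=set0 by case: contY => _ [].
pose b (_ : 'I_1) : CX_structure R X := mkcts cu.
have inf_eq := ecX _ _ (ex_intro _ Y (conj contY (cstar_isomorphic_refl _)))
  (CX_comp_embedding cg gs) 1 1 (root_formula n) (fun=> 1%N) b.
have infY : (qf_inf (root_formula n) (fun=> 1%N) (CX_comp cg \o b) <= 0)%E.
  pose w (_ : 'I_1) : CX_structure R Y := mkcts cz.
  apply: ge_ereal_inf; eexists.
    by exists w => // j; apply: CX_norm_le Y0 _ => y; rewrite Re_norm_le; exact: z1.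
  rewrite lee_fin; apply: CX_norm_le Y0 _ => y.
  rewrite Re_norm_le [X in `|X|](_ : _ = 0) ?normr0//.
  pose val i : CX_structure R Y :=
    match i with inl j => w j | inr j => (CX_comp cg \o b) j end.
  have zE := cterm_pow_eval val (CVar R (inl ord0)) n y.
  apply: (etrans (congr1 (fun a : R[i] => a + -1 * u (g y)) zE)).
  by rewrite /= zu mulN1r subrr.
have : (qf_inf (root_formula n) (fun=> 1%N) b < e%:E)%E.
  by rewrite inf_eq (le_lt_trans infY)// lte_fin.
move=> /ereal_inf_lt[_ [v _ <-]]; rewrite lte_fin => ve.
exists (v ord0 : continuousType X R[i]^o); first exact: cts_fun.
move=> x; apply: le_lt_trans ve; apply: le_trans (CX_norm_ge _ x cX).
pose val i : CX_structure R X :=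
  match i with inl j => v j | inr j => b j end.
have vE := cterm_pow_eval val (CVar R (inl ord0)) n x.
rewrite -[X in nm (_ - X)]mul1r -mulNr.
by rewrite -(congr1 (fun a : R[i] => a + -1 * u x) vE).
Qed.

End FunctionAlgebra.

(** * Lifts of nonzero degree and threads of parameters *)

Section CircleMaps.
Context {R : realType}.

Lemma degree_lift_surj (F : R -> R) (d : int) :
  continuous F -> (forall t, F (t + 1) = F t + d%:~R) -> d != 0 ->
  forall y, exists t, F t = y.
Proof.
move=> cF Fd d0 y.
(* F takes the values F 0 + K d and F 0 - K d at K and -K; since |d| >= 1 and K exceeds |y - F 0|,
   they enclose y, in an order given by the sign of d. *)
pose K : int := Num.floor `|y - F 0| + 1.
have yK : `|y - F 0| < K%:~R by have /andP[] := floor_itv `|y - F 0|.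
have K0 : 0 < K%:~R :> R by exact: le_lt_trans yK.
have d1 : 1 <= `|d%:~R| :> R.
  by rewrite -intr_norm -[1]/(1%:~R) ler_int -gtz0_ge1 normr_gt0.
have FK : F K%:~R = F 0 + K%:~R * d%:~R.
  by rewrite -[K%:~R in LHS]add0r (degree_shift _ _ Fd) intrM.
have FNK : F (- K%:~R) = F 0 - K%:~R * d%:~R.
  by rewrite -mulrNz -[(- K)%:~R]add0r (degree_shift _ _ Fd) mulNr mulrNz intrM.
have [||t _ tF] := @IVT R F (- K%:~R) K%:~R y _ (continuous_subspaceT cF).
- by rewrite lerNl; lra.
- rewrite FK FNK ge_min le_max; move: yK d1; rewrite ltr_norml => /andP[yK1 yK2].
  have [dp|dn] := ger0P (d%:~R : R) => d1.
    have ? : 0 <= K%:~R * (d%:~R - 1) :> R by apply: mulr_ge0; lra.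
    by apply/andP; split; apply/orP; [left|right]; lra.
  have ? : 0 <= K%:~R * (- d%:~R - 1) :> R by apply: mulr_ge0; lra.
  by apply/andP; split; apply/orP; [right|left]; lra.
by exists t.
Qed.

(** Above level n preimages are chosen successively; below it the values are forced. The induction
    shifts the sequence F and prepends one forced value. *)
Lemma thread_ex (T : Type) (F : nat -> T -> T) :
  (forall n y, exists t, F n t = y) ->
  forall n t, exists s : nat -> T, s n = t /\ forall k, F k (s k.+1) = s k.
Proof.
move=> Fs n; elim: n F Fs => [|n IHn] F Fs t.
  have [G GF] := choice (fun q : nat * T => Fs q.1 q.2).
  pose s := fix s k := if k is m.+1 then G (m, s m) else t.
  by exists s; split=> // k; exact: (GF (k, s k)).
have [s [sn sF]] := IHn (fun k => F k.+1) (fun k => Fs k.+1) t.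
by exists (fun k => if k is m.+1 then s m else F 0%N (s 0%N)); split=> // -[|k].
Qed.

Lemma circle_exp_surj (z : circle R) : exists t, z = circle_exp t.
Proof.
have [t zt] := expi_surj (set_valP z : `|set_val z : R[i]| = 1).
by exists t; apply: val_inj.
Qed.

End CircleMaps.

(** * Finite exponents, and the assembly of the proof *)

Lemma supernatural_coprime (d : nat -> int) (s : supernatural) p k :
  is_supernatural_prod (fun n => `|d n|%N) s -> prime p -> s p = Some k ->
  (forall n, d n != 0) -> exists N, forall n, (N <= n)%N -> coprimez (d n) p.
Proof.
move=> + p_prime spk d0 => /(_ p p_prime); rewrite spk => -[N _ eN].
(* Consecutive partial sums are equal, so the p-adic valuation of d n is 0; as d n is nonzero, p
   does not divide it. *)
exists N => n Nn; have := eN n.+1 (leqW Nn); rewrite /= big_ord_recr /= (eN n Nn).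
rewrite -[X in _ = X]addn0 => /addnI/eqP.
rewrite eqn0Ngt logn_gt0 mem_primes p_prime.
rewrite absz_gt0 d0 /= -prime_coprime// => pd.
by rewrite coprimezE coprime_sym.
Qed.

Theorem theorem5p9 (R : realType) (X : topologicalType) (s : supernatural) :
  pseudo_solenoid R X ->
  associated_supernatural R X s ->
  (exists p : nat, prime p /\ exists k : nat, s p = Some k) ->
  ~ coexistentially_closed R X.
Proof.
move=> [contX _ _ _ _] [f [d [cf fd d0 [phi [psi [cphi cpsi phiK psiK]]] sd]]].
move=> [p [p_prime [k spk]]] ecX.
have [N dp] := supernatural_coprime sd p_prime spk d0.
have [F FP] := choice fd.
have Fc n : continuous (F n) by case: (FP n).
have Fl n t : f n (circle_exp t) = circle_exp (F n t) by case: (FP n).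
have Fd n t : F n (t + 1) = F n t + (d n)%:~R by case: (FP n).
have Fs n y : exists t, F n t = y by exact: degree_lift_surj (Fc n) (Fd n) (d0 n) y.
pose coord n x : circle R := set_val (phi x) n.
have coord_cont n : continuous (coord n).
  have proj_cont : continuous ((proj n : prod_topology (fun=> circle R) -> circle R)
      \o (set_val : circle_limit f -> _)).
    move=> w; apply: continuous_comp; first exact: initial_continuous.
    exact: proj_continuous.
  by move=> x; exact: (continuous_comp (cphi x) (proj_cont (phi x))).
have coordF n x : f n (coord n.+1 x) = coord n x by exact: (set_valP (phi x)).
(* Starting at index N leaves only degrees prime to p. *)
pose c n x : R[i]^o := set_val (coord (N + n)%N x).
have cE n x t : c n x = expi t -> coord (N + n)%N x = circle_exp t.
  by move=> xt; apply: val_inj.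
have c_continuous n : continuous (c n).
  move=> x; apply: (@continuous_comp _ _ _ (coord (N + n)%N) set_val).
    exact: coord_cont.
  exact: initial_continuous.
have c_expi n x : exists t, c n x = expi t.
  have [t xt] := circle_exp_surj (coord (N + n)%N x).
  by exists t; rewrite /c xt.
have c_bond n x t : c n.+1 x = expi t -> c n x = expi (F (N + n)%N t).
  move=> /cE xt; by rewrite /c -coordF -addnS xt Fl.
have c_inj x y : (forall n, c n x = c n y) -> x = y.
  move=> cxy; have coordN n : coord (N + n)%N x = coord (N + n)%N y.
    by apply: val_inj; exact: cxy.
  rewrite -(phiK x) -(phiK y); congr psi; apply: val_inj; apply/funext => n.
  have [Nn|nN] := leqP N n; first by have := coordN (n - N)%N; rewrite subnKC.
  (* The discarded coordinates are recovered from coordinate N by descending along the bonding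
     maps. *)
  suff : forall m, coord (N - m)%N x = coord (N - m)%N y.
    by move=> /(_ (N - n)%N); rewrite subKn // ltnW.
  elim=> [|m IHm]; first by have := coordN 0%N; rewrite addn0 subn0.
  (* Subtraction is truncated: from m = N on, both indices are 0. *)
  have [mN|Nm] := ltnP m N; last first.
    have NSm : (N - m.+1 == 0)%N := leqW Nm.
    by move: IHm; rewrite (eqP (Nm : N - m == 0)%N) (eqP NSm).
  by rewrite -coordF -[RHS]coordF subnSK // IHm.
have c_surj n t : exists x, c n x = expi t.
  (* A thread of real parameters through t exponentiates to a point of the limit. *)
  have [r [rn rF]] := thread_ex Fs (N + n)%N t.
  have rlim : [set x : prod_topology (fun=> circle R) | forall k, f k (x k.+1) = x k]
      (fun k => circle_exp (r k)).
    by move=> k'; rewrite Fl rF.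
  pose w : circle_limit f := exist (fun w => w \in _) _ (mem_set rlim).
  exists (psi w).
  by rewrite /c /coord psiK -rn.
have p0 := prime_gt0 p_prime.
have dpN n : coprimez (d (N + n)%N) p by apply: dp; exact: leq_addr.
have contY : continuum (root_cover c p).
  exact: (@root_cover_continuum R X c (fun n => F (N + n)%N) (fun n => d (N + n)%N)).
have [Y0 _ connY] := contY.2.
have [e e0 eP] := no_approximate_root c_expi (prime_gt1 p_prime) connY Y0.
have [||v cv vP] := @coexistentially_closed_root R X (root_cover c p)
  (@cover_base R X c p) (c 0%N) (@cover_root R X c p) p ecX contY
  (@cover_base_continuous R X c p) _ (c_continuous 0%N)
  (@cover_root_continuous R X c p) _ (@cover_rootX R X c p) e e0.
- move=> x; have [t xt] := c_expi 0%N x.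
  have [|y [yx _]] := @cover_ex R X c p x (expi (t / p%:R)); last by exists y.
  by rewrite pdiv_expi.
- by move=> y; have [t ->] := cover_root_expi c_expi p0 y; rewrite norm_expi.
exact: eP cv vP.
Qed.
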